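(* Let $\alpha_1,\alpha_2>0$ satisfy $\alpha_1-\alpha_2\ge e(e-1)$. Let $p$ be analytic in $\mathbb{D}$ with $p(0)=1$. If $$1+\alpha_1 zp'(z)+\alpha_2 z^2p''(z)\prec e^z,$$ then $p(z)\prec e^z$.
   Context: $\mathbb{D}$ is the open unit disk. For $g,h$ analytic in $\mathbb{D}$, $g\prec h$ means there is an analytic $w:\mathbb{D}\to\mathbb{D}$ with $w(0)=0$ and $g=h\circ w$. *)

(* Defs.v *)
From Stdlib Require Import Reals.
From Coquelicot Require Import Coquelicot.
Open Scope R_scope.

Definition in_disk (z : C) : Prop := Cmod z < 1.

Definition analytic_on_disk (f : C -> C) : Prop :=
  forall z : C, in_disk z -> ex_derive (K := C_AbsRing) (V := C_NormedModule) f z.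

Definition cexp (z : C) : C := (RtoC (exp (Re z)) * (cos (Im z), sin (Im z)))%C.

Definition subordinate (g h : C -> C) : Prop :=
  exists w : C -> C,
    analytic_on_disk w /\ (forall z, in_disk z -> in_disk (w z)) /\ w 0%C = 0%C /\
    (forall z, in_disk z -> g z = h (w z)).

(* Main.v *)
(** Write [f = p - 1], [q = z f'] and [G = a1 z f' + a2 z^2 f''], so that [|G| <= e - 1] in the disk
    because [|e^w - 1| <= e - 1] for [|w| <= 1]. The point is that [|f| <= 1/2].

    For [r < 1] let [z0] maximise [|f|^2 (9 |z|^(-9/5) + 1)] over [|z| <= r]. The exponent [9/5 < 2] makes
    the function vanish at [0], and the weight is strictly log-convex in [log |z|], so the function is
    strictly log-subharmonic and [|z0| = r]. There the radial derivative gives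
    [Re (q conj f) >= 4/5 |f|^2], and the tangential second derivative gives
    [Re (z q' conj f) >= |q|^2]. As [G = (a1 - a2) q + a2 z q'], it follows that
    [4/5 (a1 - a2) |f|^2 <= Re (G conj f) <= (e - 1) |f|], hence [|f(z0)| <= 5/(4e) <= 1/2].
    The weight decreases in [|z|], so this bounds [|f|] on the whole circle [|z| = r].

    Finally [|p - 1| <= 1/2] implies [|log p| < 1], and [w = log p] is the subordinating function. *)
Require Import Defs.
From Stdlib Require Import Reals Lra Psatz Classical ClassicalEpsilon.
From Coquelicot Require Import Coquelicot.
Open Scope R_scope.

(** * Complex derivatives and the Cauchy-Riemann equations *)

Notation is_derive_C := (is_derive (K := C_AbsRing) (V := C_NormedModule)).

Lemma is_derive_C_eps (f : C -> C) (z l : C) :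
  is_derive_C f z l <->
  forall eps : R, 0 < eps -> exists d : R, 0 < d /\
    forall w, Cmod (w - z) < d ->
      Cmod (f w - f z - (w - z) * l) <= eps * Cmod (w - z).
Proof.
split.
- intros [_ H] eps Heps.
  destruct (H z (fun P HP => HP) (mkposreal eps Heps)) as [d Hd].
  exists d; split; [apply cond_pos|].
  intros w Hw; exact (Hd w Hw).
- intros H; split.
  + apply is_linear_scal_l.
  + intros x Hx eps.
    apply (is_filter_lim_locally_unique (V := AbsRing_NormedModule C_AbsRing)) in Hx.
    subst x.
    destruct (H eps (cond_pos eps)) as [d [Hd Hd']].
    exists (mkposreal d Hd); intros w Hw; exact (Hd' w Hw).
Qed.

(* The two normed modules share the norm but not the uniform structure, so they are not convertible. *)
Lemma is_derive_C_AbsRing (f : C -> C) (z l : C) :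
  is_derive_C f z l <-> is_derive (K := C_AbsRing) (V := AbsRing_NormedModule C_AbsRing) f z l.
Proof.
split; intros [_ H]; (split; [apply is_linear_scal_l|exact H]).
Qed.

(** Cauchy-Riemann: multiplication by [l] is the real matrix with rows [(Re l, - Im l)] and
    [(Im l, Re l)]. The forward direction serves derivatives along curves, the converse the
    logarithm. *)
Lemma is_derive_C_iff_CR (f : C -> C) (z l : C) :
  is_derive_C f z l <->
  differentiable_pt_lim (fun x y => Re (f (x, y))) (Re z) (Im z) (Re l) (- Im l) /\
  differentiable_pt_lim (fun x y => Im (f (x, y))) (Re z) (Im z) (Im l) (Re l).
Proof.
rewrite is_derive_C_eps.
destruct z as [x y], l as [a b]; simpl.
split.
- intros H.
  enough (K : forall eps : posreal, locally_2d (fun u v =>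
     Cmod (f (u, v) - f (x, y) - ((u, v) - (x, y)) * (a, b)) <=
       eps * Rmax (Rabs (u - x)) (Rabs (v - y))) x y).
  { split; intros eps; apply (fun H => locally_2d_impl _ _ x y H (K eps)); apply locally_2d_forall;
      intros u v Huv; eapply Rle_trans; try exact Huv; (eapply Rle_trans; [|apply Rmax_Cmod]).
    - eapply Rle_trans; [|apply Rmax_l]. simpl. right; f_equal; unfold Re; ring.
    - eapply Rle_trans; [|apply Rmax_r]. simpl. right; f_equal; unfold Im; ring. }
  intros eps.
  (* The modulus is at most [sqrt 2] times the max norm underlying [locally_2d]; both [eps] and [d]
     are divided by this factor. *)
  assert (s2 : 0 < sqrt 2) by (apply sqrt_lt_R0; lra).
  destruct (H (eps / sqrt 2)) as [d [Hd Hd']].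
  { apply Rdiv_lt_0_compat; [apply cond_pos|assumption]. }
  exists (mkposreal (d / sqrt 2) (Rdiv_lt_0_compat _ _ Hd s2)); simpl.
  intros u v Hu Hv.
  assert (E : Cmod ((u, v) - (x, y)) <= sqrt 2 * Rmax (Rabs (u - x)) (Rabs (v - y)))
    by apply (Cmod_2Rmax ((u, v) - (x, y))%C).
  eapply Rle_trans; [apply Hd'|].
  + eapply Rle_lt_trans; [exact E|].
    apply Rlt_le_trans with (sqrt 2 * (d / sqrt 2)).
    * apply Rmult_lt_compat_l; [assumption|]. now apply Rmax_lub_lt.
    * right; field; lra.
  + apply Rle_trans with (eps / sqrt 2 * (sqrt 2 * Rmax (Rabs (u - x)) (Rabs (v - y)))).
    * apply Rmult_le_compat_l; [|exact E].
      apply Rlt_le, Rdiv_lt_0_compat; [apply cond_pos|assumption].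
    * right; field; lra.
- intros [H1 H2] eps Heps.
  assert (Heps' : 0 < eps / sqrt 2).
  { apply Rdiv_lt_0_compat; [assumption|apply sqrt_lt_R0; lra]. }
  destruct (H1 (mkposreal _ Heps')) as [d1 K1].
  destruct (H2 (mkposreal _ Heps')) as [d2 K2].
  simpl in K1, K2.
  exists (Rmin d1 d2); split.
  { apply Rmin_pos; apply cond_pos. }
  intros [u v] Hw.
  pose proof (Rmax_Cmod ((u, v) - (x, y))%C) as E; simpl in E.
  assert (Eu : Rabs (u - x) <= Cmod ((u, v) - (x, y))).
  { eapply Rle_trans; [apply Rmax_l|exact E]. }
  assert (Ev : Rabs (v - y) <= Cmod ((u, v) - (x, y))).
  { eapply Rle_trans; [apply Rmax_r|exact E]. }
  pose proof (Rmin_l d1 d2); pose proof (Rmin_r d1 d2).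
  specialize (K1 u v ltac:(lra) ltac:(lra)).
  specialize (K2 u v ltac:(lra) ltac:(lra)).
  eapply Rle_trans; [apply Cmod_2Rmax|].
  apply Rle_trans with (sqrt 2 * (eps / sqrt 2 * Cmod ((u, v) - (x, y)))).
  + apply Rmult_le_compat_l; [apply sqrt_pos|].
    apply Rmax_lub; simpl.
    * replace (Rabs _) with (Rabs (Re (f (u, v)) - Re (f (x, y)) - (a * (u - x) + - b * (v - y))))
        by (f_equal; unfold Re; ring).
      eapply Rle_trans; [exact K1|].
      apply Rmult_le_compat_l; [lra|exact E].
    * replace (Rabs _) with (Rabs (Im (f (u, v)) - Im (f (x, y)) - (b * (u - x) + a * (v - y))))
        by (f_equal; unfold Im; ring).
      eapply Rle_trans; [exact K2|].
      apply Rmult_le_compat_l; [lra|exact E].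
  + right; field. apply Rgt_not_eq, sqrt_lt_R0; lra.
Qed.

Lemma is_derive_C_comp_curve (f : C -> C) (x y : R -> R) (t x' y' : R) (l : C) :
  is_derive_C f (x t, y t) l -> is_derive x t x' -> is_derive y t y' ->
  is_derive (fun s => Re (f (x s, y s))) t (Re (l * (x', y'))) /\
  is_derive (fun s => Im (f (x s, y s))) t (Im (l * (x', y'))).
Proof.
intros Hf Hx Hy.
apply is_derive_C_iff_CR in Hf; destruct Hf as [H1 H2].
apply is_derive_Reals in Hx. apply is_derive_Reals in Hy.
split; apply is_derive_Reals.
- pose proof (derivable_pt_lim_comp_2d _ _ _ _ _ _ _ _ H1 Hx Hy) as H.
  replace (Re _) with (Re l * x' + - Im l * y') by (simpl; unfold Re, Im; ring). exact H.
- pose proof (derivable_pt_lim_comp_2d _ _ _ _ _ _ _ _ H2 Hx Hy) as H.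
  replace (Im (l * _)) with (Im l * x' + Re l * y') by (simpl; unfold Re, Im; ring). exact H.
Qed.

(** * Maxima of upper semicontinuous functions *)

Definition upper_semicontinuous (u : R -> R -> R) : Prop :=
  forall x y c, u x y < c -> locally_2d (fun x' y' => u x' y' < c) x y.

(** Compactness of the rectangle is used twice: to bound [u] above, and to turn local gaps below an
    unattained supremum into a uniform gap. Semicontinuity, rather than continuity, lets [u] drop to
    a constant outside a closed disk. *)
Lemma upper_semicontinuous_attains_max (u : R -> R -> R) (a b a' b' : R) :
  a <= b -> a' <= b' -> upper_semicontinuous u ->
  exists x0 y0, a <= x0 <= b /\ a' <= y0 <= b' /\
    forall x y, a <= x <= b -> a' <= y <= b' -> u x y <= u x0 y0.
Proof.
intros Hab Hab' Hu.
assert (Hbd : exists M, forall x y, a <= x <= b -> a' <= y <= b' -> u x y <= M).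
(* One number [d] is both the radius and, through [/ d], the local bound, so a uniform lower bound
   on the gauge bounds [u]. *)
{ assert (Hd : forall x y, exists d : posreal, forall x' y',
     Rabs (x' - x) < d -> Rabs (y' - y) < d -> u x' y' < / d).
  { intros x y.
    destruct (Hu x y (Rabs (u x y) + 1)) as [d Hd].
    { pose proof (Rle_abs (u x y)); lra. }
    assert (P : 0 < / (Rabs (u x y) + 1)).
    { apply Rinv_0_lt_compat. pose proof (Rabs_pos (u x y)); lra. }
    assert (Q : 0 < Rmin d (/ (Rabs (u x y) + 1))).
    { apply Rmin_pos; [apply cond_pos|exact P]. }
    exists (mkposreal _ Q); simpl. intros x' y' Hx Hy.
    apply Rlt_le_trans with (Rabs (u x y) + 1).
    - apply Hd; eapply Rlt_le_trans; try eassumption; apply Rmin_l.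
    - apply Rle_trans with (/ / (Rabs (u x y) + 1)); [rewrite Rinv_inv; lra|].
      apply Rinv_le_contravar; [exact Q|apply Rmin_r]. }
  set (delta := fun x y => proj1_sig (constructive_indefinite_description _ (Hd x y))).
  destruct (compactness_value_2d a b a' b' delta) as [d K].
  exists (/ d). intros x y Hx Hy.
  (* The covering cell is available only under a double negation, hence the argument by
     contradiction. *)
  apply Rnot_lt_le; intros Hlt. apply (K x y Hx Hy).
  intros [v [w [_ [_ [H1 [H2 H3]]]]]].
  revert H1 H2 H3. unfold delta.
  destruct (constructive_indefinite_description _ (Hd v w)) as [e He]; simpl.
  intros H1 H2 H3.
  specialize (He x y H1 H2).
  assert (/ e <= / d) by (apply Rinv_le_contravar; [apply cond_pos|assumption]). lra. }
destruct (completeness (fun r => exists x y, a <= x <= b /\ a' <= y <= b' /\ r = u x y)) as [S [HS1 HS2]].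
{ destruct Hbd as [M HM]. exists M. intros r [x [y [Hx [Hy ->]]]]. auto. }
{ exists (u a a'), a, a'. repeat split; lra. }
apply NNPP; intros Hno.
assert (Hlt : forall x y, a <= x <= b -> a' <= y <= b' -> u x y < S).
{ intros x y Hx Hy.
  destruct (HS1 (u x y)) as [?|E]; [now exists x, y|assumption|].
  exfalso; apply Hno. exists x, y. repeat split; try tauto.
  intros x' y' Hx' Hy'. rewrite E. apply HS1. now exists x', y'. }
assert (Hd : forall x y, exists d : posreal, a <= x <= b -> a' <= y <= b' -> forall x' y',
     Rabs (x' - x) < d -> Rabs (y' - y) < d -> u x' y' < S - d).
{ intros x y.
  destruct (classic (a <= x <= b /\ a' <= y <= b')) as [[Hx Hy]|Hn].
  (* Off the rectangle the condition is vacuous and 1 is a default radius. *)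
  2: { exists (mkposreal 1 Rlt_0_1). tauto. }
  specialize (Hlt x y Hx Hy).
  destruct (Hu x y ((u x y + S) / 2)) as [d Hd]; [lra|].
  assert (Q : 0 < Rmin d ((S - u x y) / 2)).
  { apply Rmin_pos; [apply cond_pos|lra]. }
  exists (mkposreal _ Q); simpl. intros _ _ x' y' Hx' Hy'.
  pose proof (Rmin_l d ((S - u x y) / 2)); pose proof (Rmin_r d ((S - u x y) / 2)).
  specialize (Hd x' y' ltac:(lra) ltac:(lra)). lra. }
set (delta := fun x y => proj1_sig (constructive_indefinite_description _ (Hd x y))).
destruct (compactness_value_2d a b a' b' delta) as [d K].
assert (S <= S - d).
{ apply HS2. intros r [x [y [Hx [Hy ->]]]].
  apply Rnot_lt_le; intros Hl. apply (K x y Hx Hy).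
  intros [v [w [Hv [Hw [H1 [H2 H3]]]]]].
  revert H1 H2 H3. unfold delta.
  destruct (constructive_indefinite_description _ (Hd v w)) as [e He]; simpl.
  intros H1 H2 H3.
  specialize (He Hv Hw x y H1 H2). lra. }
pose proof (cond_pos d); lra.
Qed.

(** * Derivative tests at a maximum *)

Lemma left_max_derive (h : R -> R) (l : R) :
  is_derive h 0 l -> (exists d, 0 < d /\ forall t, - d < t <= 0 -> h t <= h 0) -> 0 <= l.
Proof.
intros Hh [d [Hd Hmax]].
apply is_derive_Reals in Hh.
apply Rnot_lt_le; intros Hl.
destruct (Hh (- l) ltac:(lra)) as [e He].
set (t := - (Rmin d e / 2)).
pose proof (cond_pos e).
pose proof (Rmin_pos _ _ Hd (cond_pos e)).
pose proof (Rmin_l d e); pose proof (Rmin_r d e).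
assert (Ht : t < 0) by (unfold t; lra).
specialize (He t ltac:(lra)).
rewrite Rabs_left in He by lra.
specialize (He ltac:(unfold t; lra)).
specialize (Hmax t ltac:(unfold t in *; lra)).
rewrite Rplus_0_l in He.
apply Rabs_def2 in He; destruct He as [He _].
(* Only values to the left of 0 are compared, since the maximum over a closed disk may lie on its
   boundary circle. *)
assert (0 <= (h t - h 0) / t).
{ replace ((h t - h 0) / t) with ((h 0 - h t) * / - t) by (field; lra).
  apply Rmult_le_pos; [lra|]. apply Rlt_le, Rinv_0_lt_compat; lra. }
lra.
Qed.

(** The one-sided test applied to both sides gives [h1 0 = 0]. If [l > 0], then [h1] is positive
    just to the right of 0 and the mean value theorem makes [h] exceed [h 0]. *)
Lemma local_max_derive2 (h h1 : R -> R) (l : R) :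
  (exists d, 0 < d /\ forall t, - d < t < d -> is_derive h t (h1 t) /\ h t <= h 0) ->
  is_derive h1 0 l -> h1 0 = 0 /\ l <= 0.
Proof.
intros [d [Hd H]] Hl.
assert (Z : h1 0 = 0).
{ apply Rle_antisym.
  - assert (0 <= - h1 0); [|lra].
    apply (left_max_derive (fun t => h (- t))).
    + evar_last.
      * apply (is_derive_comp h (fun t => - t)).
        { rewrite Ropp_0. apply H; lra. }
        { auto_derive; [exact I|reflexivity]. }
      * unfold scal; simpl; unfold mult; simpl; ring.
    + exists d; split; [assumption|]. intros t Ht. rewrite Ropp_0. apply H; lra.
  - apply (left_max_derive h).
    + apply H; lra.
    + exists d; split; [assumption|]. intros t Ht. apply H; lra. }
split; [exact Z|].
apply Rnot_lt_le; intros Hpos.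
apply is_derive_Reals in Hl.
destruct (Hl l Hpos) as [e He].
set (t := Rmin d e / 2).
pose proof (cond_pos e).
pose proof (Rmin_pos _ _ Hd (cond_pos e)).
pose proof (Rmin_l d e); pose proof (Rmin_r d e).
destruct (MVT_cor2 h h1 0 t) as [c [Hc Hc']].
{ unfold t; lra. }
{ intros c Hc. apply is_derive_Reals, H. unfold t in Hc; lra. }
assert (0 < h1 c).
{ specialize (He c ltac:(lra)).
  rewrite Rabs_pos_eq in He by lra.
  specialize (He ltac:(unfold t in *; lra)).
  rewrite Rplus_0_l, Z in He. apply Rabs_def2 in He; destruct He as [_ He].
  replace (h1 c) with (((h1 c - 0) / c) * c) by (field; lra).
  apply Rmult_lt_0_compat; lra. }
destruct (H t) as [_ Hm]; [unfold t; lra|].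
assert (0 < h1 c * (t - 0)) by (apply Rmult_lt_0_compat; unfold t; lra).
lra.
Qed.

(** * The bound for |e^w - 1| on the closed unit disk *)

Lemma one_sub_cos_le (y : R) : 2 * (1 - cos y) <= y * y.
Proof.
replace y with (2 * (y / 2)) at 1 by field.
rewrite cos_2a_sin.
assert (H : forall x, 0 <= x -> sin x * sin x <= x * x).
{ intros x [Hx|<-]; [|rewrite sin_0; lra].
  pose proof (sin_lt_x x Hx).
  destruct (Rle_lt_dec x 1).
  - assert (0 <= sin x) by (apply sin_ge_0; pose proof PI2_1; lra). nra.
  - pose proof (SIN_bound x). nra. }
destruct (Rle_lt_dec 0 y) as [Hy|Hy].
- specialize (H (y / 2) ltac:(lra)). lra.
- specialize (H (- (y / 2)) ltac:(lra)). rewrite sin_neg in H. lra.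
Qed.

(** For w = x + iy, |e^w - 1|^2 = (e^x - 1)^2 + 2 e^x (1 - cos y), and 2 (1 - cos y) <= y^2 <= 1 -
    x^2. The resulting majorant is nondecreasing in x, so its value at x = 1 bounds it. *)
Lemma exp_sq_bound (x : R) : -1 <= x <= 1 ->
  (exp x - 1) * (exp x - 1) + exp x * (1 - x * x) <= (exp 1 - 1) * (exp 1 - 1).
Proof.
intros [Hx [Hx1| ->]]; [|lra].
set (g := fun t => (exp t - 1) * (exp t - 1) + exp t * (1 - t * t)).
set (g' := fun t => exp t * (2 * exp t - (1 + t) * (1 + t))).
destruct (MVT_cor2 g g' x 1 Hx1) as [c [E Hc]].
{ intros c _. apply is_derive_Reals. unfold g, g'. auto_derive; [exact I|]. ring. }
assert (0 <= g' c).
{ apply Rmult_le_pos; [apply Rlt_le, exp_pos|].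
  pose proof (exp_ineq1_le c). nra. }
assert (0 <= g' c * (1 - x)) by (apply Rmult_le_pos; lra).
unfold g in E. lra.
Qed.

Lemma Cmod_sqr (z : C) : Cmod z * Cmod z = Re z * Re z + Im z * Im z.
Proof.
unfold Cmod, Re, Im. rewrite sqrt_sqrt; nra.
Qed.

Lemma Cmod_le_of_sqr (z : C) (r : R) : 0 <= r ->
  Re z * Re z + Im z * Im z <= r * r -> Cmod z <= r.
Proof.
intros Hr H. rewrite <- Cmod_sqr in H. pose proof (Cmod_ge_0 z). nra.
Qed.

Lemma Cmod_cexp_sub_1 (w : C) : Cmod w <= 1 -> Cmod (cexp w - 1) <= exp 1 - 1.
Proof.
intros Hw.
assert (1 <= exp 1) by (pose proof (exp_ineq1_le 1); lra).
apply Cmod_le_of_sqr; [lra|].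
pose proof (Cmod_sqr w). pose proof (Cmod_ge_0 w).
destruct w as [x y]; unfold cexp, Re, Im in *; simpl in *.
pose proof (exp_sq_bound x ltac:(nra)).
pose proof (one_sub_cos_le y). pose proof (exp_pos x).
pose proof (sin2_cos2 y); unfold Rsqr in *.
assert (exp x * (2 * (1 - cos y)) <= exp x * (1 - x * x)) by (apply Rmult_le_compat_l; nra).
nra.
Qed.

(** * Numerical bounds *)

Lemma exp_1_ge : 5 / 2 <= exp 1.
Proof.
(* At 1 the inequality 1 + x <= e^x yields only 2; at 1/8, followed by three squarings, it yields
   more than 5/2. *)
replace 1 with (1/8 + 1/8 + (1/8 + 1/8) + (1/8 + 1/8 + (1/8 + 1/8))) by field.
rewrite !exp_plus. pose proof (exp_ineq1_le (1/8)).
assert (1.26 <= exp (1/8) * exp (1/8)) by nra.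
assert (1.587 <= exp (1/8) * exp (1/8) * (exp (1/8) * exp (1/8))) by nra.
nra.
Qed.

Lemma ln_2_le : ln 2 <= 4 / 5.
Proof.
rewrite <- (ln_exp (4 / 5)). apply ln_le; [lra|].
replace (4/5) with (1/5 + 1/5 + (1/5 + 1/5)) by field.
rewrite !exp_plus. pose proof (exp_ineq1_le (1/5)).
assert (1.44 <= exp (1/5) * exp (1/5)) by nra. nra.
Qed.

(** * The principal logarithm on the right half-plane *)

Definition clog (z : C) : C :=
  (ln (Re z * Re z + Im z * Im z) / 2, atan (Im z / Re z)).

Lemma cexp_clog (z : C) : 0 < Re z -> cexp (clog z) = z.
Proof.
destruct z as [x y]; unfold cexp, clog; simpl; intros Hx.
rewrite cos_atan, sin_atan. unfold Rsqr.
assert (N : 0 < x * x + y * y) by nra.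
(* The modulus in the form that cancels the square roots in the cosine and sine of
   [atan (y / x)]. *)
assert (E : exp (ln (x * x + y * y) / 2) = x * sqrt (1 + y / x * (y / x))).
{ assert (S : 0 < 1 + y / x * (y / x)) by nra.
  apply Rsqr_inj.
  - apply Rlt_le, exp_pos.
  - apply Rmult_le_pos; [lra|apply sqrt_pos].
  - unfold Rsqr. rewrite <- exp_plus.
    replace (ln _ / 2 + ln _ / 2) with (ln (x * x + y * y)) by field.
    rewrite exp_ln by assumption.
    transitivity (x * x * (sqrt (1 + y / x * (y / x)) * sqrt (1 + y / x * (y / x)))); [|ring].
    rewrite sqrt_sqrt by lra. field; lra. }
rewrite E.
assert (S : 0 < sqrt (1 + y / x * (y / x))) by (apply sqrt_lt_R0; nra).
unfold RtoC, Cmult; simpl; f_equal; field; lra.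
Qed.

Lemma continuous_div_normsq (g : R * R -> R) (x y : R) :
  0 < x -> continuous g (x, y) ->
  continuous (fun u : R * R => g u * / (fst u * fst u + snd u * snd u)) (x, y).
Proof.
intros Hx Hg.
apply (continuous_mult (K := R_AbsRing) g); [exact Hg|].
apply (continuous_comp (fun u : R * R => fst u * fst u + snd u * snd u) Rinv);
  [|apply continuous_Rinv; simpl; nra].
apply (continuous_plus (V := R_NormedModule)); apply (continuous_mult (K := R_AbsRing));
  (apply continuous_fst || apply continuous_snd).
Qed.

Lemma locally_Re_pos (x y : R) : 0 < x -> locally (x, y) (fun u : R * R => 0 < fst u).
Proof.
intros Hx. exists (mkposreal x Hx). intros [u v] [H _].
apply Rabs_def2 in H. unfold minus, plus, opp in H; simpl in *. lra.
Qed.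

(** By Cauchy-Riemann it is enough that both components be real differentiable with the right
    partials. The criterion takes the x-partial near the point, continuous there, and the y-partial
    at the point. *)
Lemma is_derive_clog (z : C) : 0 < Re z -> is_derive_C clog z (/ z)%C.
Proof.
destruct z as [x y]; intros Hx; simpl in Hx.
apply is_derive_C_iff_CR.
unfold clog, Cinv; simpl.
assert (N : 0 < x * x + y * y) by nra.
split; apply filterdiff_differentiable_pt_lim.
- eapply filterdiff_ext_lin.
  + apply (is_derive_filterdiff (fun u v => ln (u * u + v * v) / 2) x y
      (fun u v => u * / (u * u + v * v)) (y * / (x * x + y * y))).
    * generalize (locally_Re_pos x y Hx). apply filter_imp; intros [u v] Hu; simpl in *.
      auto_derive; [nra|]. field. nra.
    * auto_derive; [nra|]. field. nra.
    * apply (continuous_div_normsq fst); [assumption|apply continuous_fst].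
  + intros [u v]; unfold plus, scal; simpl; unfold mult; simpl. field. nra.
- eapply filterdiff_ext_lin.
  + apply (is_derive_filterdiff (fun u v => atan (v / u)) x y
      (fun u v => - v * / (u * u + v * v)) (x * / (x * x + y * y))).
    * generalize (locally_Re_pos x y Hx). apply filter_imp; intros [u v] Hu; simpl in *.
      auto_derive; [lra|]. field. split; nra.
    * auto_derive; [lra|]. field. split; nra.
    * apply (continuous_div_normsq (fun u => - snd u)); [assumption|].
      apply (continuous_opp (V := R_NormedModule)), continuous_snd.
  + intros [u v]; unfold plus, scal; simpl; unfold mult; simpl. field. nra.
Qed.

Lemma atan_sqr_le (x : R) : atan x * atan x <= x * x.
Proof.
assert (H : forall t, 0 <= t -> 0 <= atan t <= t).
{ intros t [Ht|<-]; [|rewrite atan_0; lra].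
  destruct (MVT_cor2 atan (fun u => / (1 + u ^ 2)) 0 t Ht) as [c [E Hc]].
  { intros c _. apply derivable_pt_lim_atan. }
  rewrite atan_0 in E.
  assert (0 < / (1 + c ^ 2)) by (apply Rinv_0_lt_compat; nra).
  assert (/ (1 + c ^ 2) <= 1) by (rewrite <- Rinv_1; apply Rinv_le_contravar; nra).
  nra. }
destruct (Rle_lt_dec 0 x) as [Hx|Hx].
- specialize (H x Hx). nra.
- specialize (H (- x) ltac:(lra)). rewrite atan_opp in H. nra.
Qed.

Lemma Re_pos_of_near_1 (z : C) : Cmod (z - 1) <= 1 / 2 -> 0 < Re z.
Proof.
intros H. pose proof (Rmax_Cmod (z - 1)%C) as H'.
pose proof (Rmax_l (Rabs (fst (z - 1)%C)) (Rabs (snd (z - 1)%C))).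
destruct z as [x y]; simpl in *.
pose proof (Rcomplements.Rabs_le_between (x + - (1)) (1/2)) as [K _].
specialize (K ltac:(lra)). lra.
Qed.

(** Here |log |z|| <= ln 2 <= 4/5 and the squared argument is at most tan^2 <= 1/3, while 16/25 +
    1/3 < 1. *)
Lemma Cmod_clog_lt_1 (z : C) : Cmod (z - 1) <= 1 / 2 -> Cmod (clog z) < 1.
Proof.
intros H. pose proof (Re_pos_of_near_1 z H) as Hx.
pose proof (Cmod_sqr (z - 1)) as E. pose proof (Cmod_ge_0 (z - 1)).
destruct z as [x y]; unfold clog, Re, Im in *; simpl in *.
assert (D : (x - 1) * (x - 1) + y * y <= 1 / 4) by nra.
assert (L : - (4 / 5) <= ln (x * x + y * y) / 2 <= 4 / 5).
{ pose proof ln_2_le.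
  assert (ln 4 = ln 2 + ln 2) by (rewrite <- ln_mult by lra; f_equal; lra).
  split.
  - assert (- ln 4 <= ln (x * x + y * y)); [|lra].
    rewrite <- ln_Rinv by lra. apply ln_le; [lra|].
    assert (1 / 2 <= x) by nra. nra.
  - assert (ln (x * x + y * y) <= ln 4); [|lra].
    apply ln_le; [nra|]. assert (x <= 3/2) by nra. nra. }
assert (A : y / x * (y / x) <= 1 / 3).
{ replace (y / x * (y / x)) with (y * y * / (x * x)) by (field; lra).
  apply Rmult_le_reg_r with (x * x); [nra|].
  rewrite Rmult_assoc, Rinv_l by nra.
  (* The claim 3 y^2 <= x^2 reduces to this square; x = 3/4 is where the tangent from the origin
     touches the circle |z - 1| = 1/2. *)
  pose proof (Rle_0_sqr (2 * x - 3 / 2)); unfold Rsqr in *. lra. }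
pose proof (atan_sqr_le (y / x)).
pose proof (Cmod_sqr (ln (x * x + y * y) / 2, atan (y / x))) as M.
pose proof (Cmod_ge_0 (ln (x * x + y * y) / 2, atan (y / x))).
unfold Re, Im in M; simpl in M.
assert (ln (x * x + y * y) / 2 * (ln (x * x + y * y) / 2) <= 16 / 25) by nra.
nra.
Qed.

(** * Dilations and rotations: logarithmic polar coordinates *)

Definition dilate (z : C) (s : R) : C := (exp s * Re z, exp s * Im z).
Definition rotate (z : C) (t : R) : C :=
  (Re z * cos t - Im z * sin t, Re z * sin t + Im z * cos t).

Lemma dilate_0 (z : C) : dilate z 0 = z.
Proof. unfold dilate; rewrite exp_0; destruct z; simpl; f_equal; ring. Qed.

Lemma rotate_0 (z : C) : rotate z 0 = z.
Proof. unfold rotate; rewrite cos_0, sin_0; destruct z; simpl; f_equal; ring. Qed.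

Lemma Cmod_dilate (z : C) (s : R) : Cmod (dilate z s) = exp s * Cmod z.
Proof.
replace (dilate z s) with (RtoC (exp s) * z)%C.
- rewrite Cmod_mult, Cmod_R, Rabs_pos_eq; [reflexivity|apply Rlt_le, exp_pos].
- destruct z; unfold dilate, RtoC, Cmult; simpl; f_equal; ring.
Qed.

Lemma Cmod_rotate (z : C) (t : R) : Cmod (rotate z t) = Cmod z.
Proof.
unfold Cmod, rotate; simpl. f_equal.
pose proof (sin2_cos2 t); unfold Rsqr in *. destruct z as [x y]; simpl.
transitivity ((x * x + y * y) * (sin t * sin t + cos t * cos t)); [ring|].
rewrite H; ring.
Qed.

(** The velocity of [dilate z s] is the point itself, so differentiation in [s] is the operator z
    d/dz. *)
Lemma is_derive_dilate (g : C -> C) (l z : C) (s : R) :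
  is_derive_C g (dilate z s) l ->
  is_derive (fun s => Re (g (dilate z s))) s (Re (dilate z s * l)) /\
  is_derive (fun s => Im (g (dilate z s))) s (Im (dilate z s * l)).
Proof.
intros H. rewrite (Cmult_comm (dilate z s) l).
apply (is_derive_C_comp_curve g (fun s => exp s * Re z) (fun s => exp s * Im z)); [exact H| |];
  (auto_derive; [exact I|ring]).
Qed.

(** The velocity is i times the point, so differentiation in [t] is i z d/dz. *)
Lemma is_derive_rotate (g : C -> C) (l z : C) (t : R) :
  is_derive_C g (rotate z t) l ->
  is_derive (fun t => Re (g (rotate z t))) t (- Im (rotate z t * l)) /\
  is_derive (fun t => Im (g (rotate z t))) t (Re (rotate z t * l)).
Proof.
intros H.
replace (- Im (rotate z t * l)) with
  (Re (l * (- (Re z * sin t + Im z * cos t), Re z * cos t - Im z * sin t)))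
  by (unfold rotate, Re, Im; simpl; ring).
replace (Re (rotate z t * l)) with
  (Im (l * (- (Re z * sin t + Im z * cos t), Re z * cos t - Im z * sin t)))
  by (unfold rotate, Re, Im; simpl; ring).
apply (is_derive_C_comp_curve g (fun t => Re z * cos t - Im z * sin t)
        (fun t => Re z * sin t + Im z * cos t)); [exact H| |];
  (auto_derive; [exact I|ring]).
Qed.

(** * The weighted squared modulus *)

Definition normsq (z : C) : R := Re z * Re z + Im z * Im z.

Lemma is_derive_dot (a b c d : R -> R) (a' b' c' d' t : R) :
  is_derive a t a' -> is_derive b t b' -> is_derive c t c' -> is_derive d t d' ->
  is_derive (fun t => a t * c t + b t * d t) t (a' * c t + a t * c' + (b' * d t + b t * d')).
Proof.
intros Ha Hb Hc Hd.
apply (is_derive_plus (K := R_AbsRing) (V := R_NormedModule));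
  apply (is_derive_mult (K := R_AbsRing)); try assumption; intros; apply Rmult_comm.
Qed.

(** The argument is s = log |z|. The summand 1 makes the weight strictly log-convex; the factor 9
    keeps it at least 10 for |z| <= 1. *)
Definition weight (s : R) : R := 9 * exp (- (9 / 5) * s) + 1.

(** At z = 0 the convention [ln 0 = 0] gives a finite weight, and the value is 0 once f(0) = 0. *)
Definition weighted (f : C -> C) (z : C) : R := normsq (f z) * weight (ln (Cmod z)).

Lemma weight_pos (s : R) : 1 < weight s.
Proof. unfold weight; pose proof (exp_pos (- (9 / 5) * s)); lra. Qed.

Lemma normsq_ge_0 (z : C) : 0 <= normsq z.
Proof. unfold normsq; nra. Qed.

Lemma weighted_ge_0 (f : C -> C) (z : C) : 0 <= weighted f z.
Proof.
apply Rmult_le_pos; [apply normsq_ge_0|]. pose proof (weight_pos (ln (Cmod z))); lra.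
Qed.

(** * First and second order conditions at a maximum *)

Section Disk.

Variables f f1 f2 : C -> C.
Hypothesis Hf : forall z, in_disk z -> is_derive_C f z (f1 z).
Hypothesis Hf1 : forall z, in_disk z -> is_derive_C f1 z (f2 z).

Let q (z : C) : C := (z * f1 z)%C.
Let q1 (z : C) : C := (f1 z + z * f2 z)%C.

Lemma is_derive_q (z : C) : in_disk z -> is_derive_C q z (q1 z).
Proof.
intros Hz. apply is_derive_C_AbsRing.
replace (q1 z) with (@plus C_AbsRing (mult one (f1 z)) (mult z (f2 z)))
  by (unfold q1, plus, mult, one; simpl; ring).
exact (is_derive_mult (K := C_AbsRing) (fun z => z) f1 z one (f2 z)
  (is_derive_id (K := C_AbsRing) z) (proj1 (is_derive_C_AbsRing _ _ _) (Hf1 z Hz)) Cmult_comm).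
Qed.

Variable z : C.
Hypothesis Hz : in_disk z.
Hypothesis Hz0 : 0 < Cmod z.

(** The pairs [(U, W)], [(A, B)], [(P, Q)] hold f and its first two derivatives under z d/dz. *)
Let U := Re (f z).
Let W := Im (f z).
Let A := Re (q z).
Let B := Im (q z).
Let P := Re (z * q1 z).
Let Q := Im (z * q1 z).

(** The weight is constant on the circle, so |f|^2 itself is maximal along rotations. Its first
    derivative -2 Im (q conj f) vanishes, and its second, 2 (|q|^2 - Re (z q' conj f)), is at most
    0. *)
Lemma tangential_conditions :
  (forall z', Cmod z' = Cmod z -> weighted f z' <= weighted f z) ->
  W * A = U * B /\ A * A + B * B <= U * P + W * Q.
Proof.
intros Hmax.
assert (Hrot : forall t, in_disk (rotate z t)) by (intros; unfold in_disk; rewrite Cmod_rotate; apply Hz).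
destruct (local_max_derive2 (fun t => normsq (f (rotate z t)))
  (fun t => 2 * (Re (q (rotate z t)) * Im (f (rotate z t)) + - Im (q (rotate z t)) * Re (f (rotate z t))))
  (2 * (A * A + B * B - (U * P + W * Q)))) as [E L].
- exists 1; split; [lra|]. intros t _. split.
  + destruct (is_derive_rotate f _ z t (Hf _ (Hrot t))) as [D1 D2].
    evar_last; [apply (is_derive_dot _ _ _ _ _ _ _ _ _ D1 D2 D1 D2)|].
    unfold q; ring.
  + rewrite rotate_0.
    specialize (Hmax _ (Cmod_rotate z t)). unfold weighted in Hmax. rewrite Cmod_rotate in Hmax.
    apply Rmult_le_reg_r in Hmax; [assumption|]. pose proof (weight_pos (ln (Cmod z))); lra.
- destruct (is_derive_rotate f _ z 0 (Hf _ (Hrot 0))) as [D1 D2].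
  destruct (is_derive_rotate q _ z 0 (is_derive_q _ (Hrot 0))) as [D3 D4].
  evar_last.
  + apply is_derive_scal, (is_derive_dot _ _ _ _ _ _ _ _ _ D3 (is_derive_opp _ _ _ D4) D2 D1).
  + rewrite !rotate_0. unfold opp, A, B, U, W, P, Q, q; simpl; unfold Re, Im. ring.
- rewrite rotate_0 in E. fold A B U W in E. split; lra.
Qed.

(** [V'] and [V''] are the derivatives of the weight in log |z|, expressed through [V] because
    [weight - 1] is an exponential of rate -9/5. *)
Let V := weight (ln (Cmod z)).
Let V' := - (9 / 5) * (V - 1).
Let V'' := - (9 / 5) * V'.

Lemma weighted_dilate (s : R) :
  weighted f (dilate z s) = normsq (f (dilate z s)) * weight (ln (Cmod z) + s).
Proof.
unfold weighted. rewrite Cmod_dilate, ln_mult, ln_exp, Rplus_comm; [reflexivity|apply exp_pos|exact Hz0].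
Qed.

Lemma is_derive_weight (c s : R) :
  is_derive (fun s => weight (c + s)) s (- (9 / 5) * (weight (c + s) - 1)).
Proof. unfold weight. auto_derive; [exact I|ring]. Qed.

Lemma is_derive_weighted_dilate (s : R) : in_disk (dilate z s) ->
  is_derive (fun s => weighted f (dilate z s)) s
   (2 * (Re (q (dilate z s)) * Re (f (dilate z s)) + Im (q (dilate z s)) * Im (f (dilate z s)))
      * weight (ln (Cmod z) + s)
    + normsq (f (dilate z s)) * (- (9 / 5) * (weight (ln (Cmod z) + s) - 1))).
Proof.
intros Hs.
apply (is_derive_ext (fun s => normsq (f (dilate z s)) * weight (ln (Cmod z) + s))).
{ intros t; symmetry; apply weighted_dilate. }
destruct (is_derive_dilate f _ z s (Hf _ Hs)) as [D1 D2].
evar_last.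
- apply (is_derive_mult (K := R_AbsRing) (fun s => normsq (f (dilate z s))));
  [apply (is_derive_dot _ _ _ _ _ _ _ _ _ D1 D2 D1 D2)|apply is_derive_weight|intros; apply Rmult_comm].
- unfold plus, mult; simpl. unfold q. ring.
Qed.

Lemma radial_condition :
  (forall z', 0 < Cmod z' <= Cmod z -> weighted f z' <= weighted f z) ->
  0 <= 2 * (A * U + B * W) * V + normsq (f z) * V'.
Proof.
intros Hmax.
apply (left_max_derive (fun s => weighted f (dilate z s))).
- evar_last; [apply is_derive_weighted_dilate; rewrite dilate_0; exact Hz|].
  rewrite dilate_0, Rplus_0_r. reflexivity.
- exists 1; split; [lra|]. intros s Hs. rewrite dilate_0. apply Hmax.
  rewrite Cmod_dilate. pose proof (exp_pos s).
  assert (exp s <= 1) by (rewrite <- exp_0; destruct (Rle_lt_or_eq_dec s 0 (proj2 Hs)) as [Hl| ->];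
    [left; now apply exp_increasing|lra]).
  nra.
Qed.

(* [log |f|^2] is harmonic off the zeros of [f] and [log weight] is strictly convex in [log |z|], so the weighted function has no interior maximum. *)
Lemma no_interior_max (d : R) : 0 < d -> normsq (f z) <> 0 ->
  ~ (forall z', 0 < Cmod z' < Cmod z + d -> weighted f z' <= weighted f z).
Proof.
intros Hd Hnz Hmax.
destruct tangential_conditions as [T1 T2].
{ intros z' E. apply Hmax; lra. }
assert (Hr : exists e, 0 < e /\ forall s, - e < s < e ->
    in_disk (dilate z s) /\ 0 < Cmod (dilate z s) < Cmod z + d).
{ set (m := Rmin 1 (Cmod z + d)).
  assert (Hm : Cmod z < m) by (apply Rmin_glb_lt; [exact Hz|lra]).
  (* For s below this number, e^s |z| < m, so the ray stays in the disk and in the region of the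
     maximum. *)
  exists (ln (m / Cmod z)).
  assert (1 < m / Cmod z) by (apply (Rmult_lt_reg_r (Cmod z)); [lra|]; unfold Rdiv; rewrite Rmult_assoc, Rinv_l; lra).
  split; [rewrite <- ln_1; apply ln_increasing; lra|].
  intros s Hs. unfold in_disk. rewrite Cmod_dilate. pose proof (exp_pos s).
  assert (exp s < m / Cmod z) by (rewrite <- (exp_ln (m / Cmod z)) by lra; apply exp_increasing; lra).
  assert (exp s * Cmod z < m).
  { replace m with (m / Cmod z * Cmod z) by (field; lra). apply Rmult_lt_compat_r; lra. }
  assert (m <= 1) by apply Rmin_l.
  assert (m <= Cmod z + d) by apply Rmin_r.
  repeat split; try lra. apply Rmult_lt_0_compat; lra. }
destruct Hr as [e [He Hr]].
destruct (local_max_derive2 (fun s => weighted f (dilate z s))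
   (fun s => 2 * (Re (q (dilate z s)) * Re (f (dilate z s)) + Im (q (dilate z s)) * Im (f (dilate z s)))
      * weight (ln (Cmod z) + s)
    + normsq (f (dilate z s)) * (- (9 / 5) * (weight (ln (Cmod z) + s) - 1)))
  (2 * (P * U + A * A + (Q * W + B * B)) * V + 2 * (2 * (A * U + B * W) * V')
     + normsq (f z) * V'')) as [E L].
- exists e; split; [assumption|]. intros s Hs. destruct (Hr s Hs) as [H1 H2]. split.
  + now apply is_derive_weighted_dilate.
  + rewrite dilate_0. now apply Hmax.
- assert (Hs : in_disk (dilate z 0)) by (rewrite dilate_0; exact Hz).
  destruct (is_derive_dilate f _ z 0 (Hf _ Hs)) as [D1 D2].
  destruct (is_derive_dilate q _ z 0 (is_derive_q _ Hs)) as [D3 D4].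
  pose proof (is_derive_weight (ln (Cmod z)) 0) as DW.
  pose proof (is_derive_dot _ _ _ _ _ _ _ _ _ D3 D4 D1 D2) as E1.
  pose proof (is_derive_dot _ _ _ _ _ _ _ _ _ D1 D2 D1 D2) as E2.
  evar_last.
  + apply (is_derive_dot (fun s => 2 * (Re (q (dilate z s)) * Re (f (dilate z s)) + Im (q (dilate z s)) * Im (f (dilate z s))))
       (fun s => normsq (f (dilate z s))) (fun s => weight (ln (Cmod z) + s)) (fun s => - (9 / 5) * (weight (ln (Cmod z) + s) - 1))).
    * apply is_derive_scal, E1.
    * apply E2.
    * apply DW.
    * apply is_derive_scal.
      apply (is_derive_minus (K := R_AbsRing) (V := R_NormedModule)); [apply DW|].
      apply (is_derive_const (K := R_AbsRing) (V := R_NormedModule)).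
  + rewrite !dilate_0, !Rplus_0_r. fold V.
    unfold minus, plus, opp, zero, V'', V', A, B, U, W, P, Q, q, normsq; simpl; unfold Re, Im. ring.
- rewrite dilate_0, Rplus_0_r in E. fold A B U W V in E. fold V' in E.
  pose proof (normsq_ge_0 (f z)) as N0.
  assert (N : normsq (f z) = U * U + W * W) by reflexivity.
  set (n := normsq (f z)) in *.
  assert (HV : 1 < V) by apply weight_pos.
  set (m := A * U + B * W) in *.
  (* q conj f is real by [T1], so its square is |q|^2 |f|^2. *)
  assert (G : m * m = n * (A * A + B * B)).
  { transitivity (n * (A * A + B * B) - (W * A - U * B) * (W * A - U * B)).
    - unfold m; rewrite N; ring.
    - rewrite T1; ring. }
  (* The tangential inequality replaces Re (z q' conj f) by |q|^2 in the radial second derivative;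
     the factor [n] prepares the use of [G]. *)
  assert (L' : n * (4 * (A * A + B * B) * V + 4 * m * V' + n * V'') <= 0).
  { assert (0 <= V * (U * P + W * Q - (A * A + B * B))) by (apply Rmult_le_pos; lra).
    assert (4 * (A * A + B * B) * V + 4 * m * V' + n * V'' <= 0) by lra. nra. }
  assert (E2 : 2 * m * V = - (n * V')) by lra.
  (* Eliminating [m] by the radial first-order condition [E2] leaves only the weight, and strict
     log-convexity contradicts the sign. *)
  assert (K : n * n * (V * V'' - V' * V') <= 0).
  { apply Rle_trans with (V * (n * (4 * (A * A + B * B) * V + 4 * m * V' + n * V''))); [|nra].
    right.
    transitivity ((2 * m * V) * (2 * m * V) + 2 * (2 * m * V) * (n * V') + n * n * (V * V'')).
    - rewrite E2; ring.
    - transitivity (4 * (m * m) * V * V + 4 * m * V * n * V' + n * n * V * V''); [ring|rewrite G; ring]. }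
  assert (V * V'' - V' * V' = 81 / 25 * (V - 1)) by (unfold V'', V'; field).
  assert (0 < n * n) by nra.
  nra.
Qed.

End Disk.

(** * Existence of a maximum on a closed disk *)

Lemma weighted_small_near_0 (f : C -> C) (l : C) (c : R) :
  is_derive_C f (RtoC 0) l -> f 0%C = 0%C -> 0 < c ->
  exists d, 0 < d /\ forall w, Cmod w < d -> weighted f w < c.
Proof.
intros Hf H0 Hc.
destruct (proj1 (is_derive_C_eps f (RtoC 0) l) Hf 1 Rlt_0_1) as [d [Hd K]].
set (M := Cmod l + 1).
assert (HM : 1 <= M) by (pose proof (Cmod_ge_0 l); unfold M; lra).
assert (X : 0 < c / (10 * (M * M))) by (apply Rdiv_lt_0_compat; nra).
(* From |f(w)| <= M |w| and 2 - 9/5 = 1/5, the weighted value is at most 10 M^2 |w|^(1/5) for |w| <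
   1; the last radius is the fifth power of c / (10 M^2). *)
exists (Rmin d (Rmin 1 (exp (5 * ln (c / (10 * (M * M))))))).
split. { repeat apply Rmin_pos; try lra; apply exp_pos. }
intros w Hw.
assert (H1 : Cmod w < d) by (eapply Rlt_le_trans; [exact Hw|apply Rmin_l]).
assert (H2 : Cmod w < 1) by (eapply Rlt_le_trans; [exact Hw|eapply Rle_trans; [apply Rmin_r|apply Rmin_l]]).
assert (H3 : Cmod w < exp (5 * ln (c / (10 * (M * M)))))
  by (eapply Rlt_le_trans; [exact Hw|eapply Rle_trans; [apply Rmin_r|apply Rmin_r]]).
clear Hw. unfold weighted.
destruct (Cmod_ge_0 w) as [Hp|Hp].
2: { symmetry in Hp. apply Cmod_eq_0 in Hp. subst w. rewrite H0. unfold normsq; simpl. lra. }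
assert (F : normsq (f w) <= M * M * (Cmod w * Cmod w)).
{ specialize (K w). rewrite H0 in K.
  replace (w - 0)%C with w in K by ring. specialize (K H1).
  assert (Cmod (f w) <= M * Cmod w).
  { replace (f w) with ((f w - 0 - w * l) + w * l)%C by ring.
    eapply Rle_trans; [apply Cmod_triangle|]. rewrite Cmod_mult. unfold M. lra. }
  unfold normsq. rewrite <- Cmod_sqr. pose proof (Cmod_ge_0 (f w)).
  replace (M * M * (Cmod w * Cmod w)) with (M * Cmod w * (M * Cmod w)) by ring.
  apply Rmult_le_compat; assumption. }
set (t := ln (Cmod w)) in *.
assert (Et : Cmod w = exp t) by (symmetry; apply exp_ln, Hp).
assert (Ht : t < 0) by (rewrite <- ln_1; apply ln_increasing; assumption).
assert (Ht' : exp (t / 5) < c / (10 * (M * M))).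
{ rewrite <- (exp_ln _ X). apply exp_increasing.
  rewrite Et in H3. apply exp_lt_inv in H3. lra. }
assert (Y : Cmod w * Cmod w * weight t <= 10 * exp (t / 5)).
{ rewrite Et, <- exp_plus. unfold weight.
  replace (exp (t + t) * _) with (9 * (exp (t + t) * exp (- (9 / 5) * t)) + exp (t + t)) by ring.
  rewrite <- exp_plus.
  replace (t + t + - (9 / 5) * t) with (t / 5) by field.
  assert (exp (t + t) < exp (t / 5)) by (apply exp_increasing; lra). lra. }
pose proof (weight_pos t).
apply Rle_lt_trans with (M * M * (10 * exp (t / 5))).
- apply Rle_trans with (M * M * (Cmod w * Cmod w) * weight t).
  + apply Rmult_le_compat_r; lra.
  + rewrite Rmult_assoc. apply Rmult_le_compat_l; [nra|exact Y].
- replace c with (M * M * (10 * (c / (10 * (M * M))))) by (field; lra).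
  apply Rmult_lt_compat_l; nra.
Qed.

Lemma continuity_2d_pt_Cmod (x y : R) : continuity_2d_pt (fun u v => Cmod (u, v)) x y.
Proof.
unfold Cmod; simpl.
apply (continuity_1d_2d_pt_comp sqrt).
- apply continuity_pt_sqrt. nra.
- repeat first [apply continuity_2d_pt_plus|apply continuity_2d_pt_mult
   |apply continuity_2d_pt_id1|apply continuity_2d_pt_id2|apply continuity_2d_pt_const].
Qed.

Lemma weighted_continuous (f : C -> C) (l : C) (x y : R) :
  is_derive_C f (x, y) l -> 0 < Cmod (x, y) ->
  continuity_2d_pt (fun u v => weighted f (u, v)) x y.
Proof.
intros Hf Hp. unfold weighted, normsq, weight.
apply is_derive_C_iff_CR in Hf. destruct Hf as [D1 D2]. simpl in D1, D2.
assert (C1 : continuity_2d_pt (fun u v => Re (f (u, v))) x y)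
  by (apply differentiable_continuity_pt; eexists; eexists; exact D1).
assert (C2 : continuity_2d_pt (fun u v => Im (f (u, v))) x y)
  by (apply differentiable_continuity_pt; eexists; eexists; exact D2).
apply continuity_2d_pt_mult.
- apply continuity_2d_pt_plus; apply continuity_2d_pt_mult; assumption.
- apply (continuity_1d_2d_pt_comp (fun r => 9 * exp (- (9 / 5) * ln r) + 1)); [|apply continuity_2d_pt_Cmod].
  apply derivable_continuous_pt. exists (9 * (- (9 / 5) * / Cmod (x, y) * exp (- (9 / 5) * ln (Cmod (x, y))))).
  apply is_derive_Reals. auto_derive; [exact Hp|ring].
Qed.

Lemma weighted_max (f f1 : C -> C) (r : R) :
  (forall z, in_disk z -> is_derive_C f z (f1 z)) -> f 0%C = 0%C -> 0 < r < 1 ->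
  exists z0, Cmod z0 <= r /\ forall z, Cmod z <= r -> weighted f z <= weighted f z0.
Proof.
intros Hf H0 Hr.
(* A value below every weighted value, taken on the open exterior: [u] is upper semicontinuous on
   the square and its maximum falls inside the disk. *)
set (u := fun x y => if Rle_dec (Cmod (x, y)) r then weighted f (x, y) else - 1).
destruct (upper_semicontinuous_attains_max u (-1) 1 (-1) 1) as [x [y [Hx [Hy K]]]]; try lra.
{ intros x y c. unfold u at 1.
  destruct (Rle_dec (Cmod (x, y)) r) as [Hle|Hgt]; intros Hc.
  - assert (Hc' : -1 < c) by (pose proof (weighted_ge_0 f (x, y)); lra).
    assert (L : locally_2d (fun x' y' => weighted f (x', y') < c) x y).
    { destruct (Cmod_ge_0 (x, y)) as [Hp|Hp].
      - assert (Hw : 0 < c - weighted f (x, y)) by lra.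
        assert (Hi : in_disk (x, y)) by (unfold in_disk; lra).
        apply (fun H => locally_2d_impl _ _ x y H (weighted_continuous f _ x y (Hf _ Hi) Hp (mkposreal _ Hw))).
        apply locally_2d_forall. intros v w H. apply Rabs_def2 in H. simpl in H. lra.
      (* The weight is singular at the origin; the decay of f replaces continuity there. *)
      - symmetry in Hp. apply Cmod_eq_0 in Hp. injection Hp as -> ->.
        change (0, 0) with (RtoC 0) in *.
        assert (Hc0 : 0 < c) by (pose proof (weighted_ge_0 f (RtoC 0)); lra).
        assert (Hi : in_disk 0) by (unfold in_disk; rewrite Cmod_0; lra).
        destruct (weighted_small_near_0 f (f1 0) c (Hf _ Hi) H0 Hc0) as [d [Hd Kd]].
        apply (fun H => locally_2d_impl _ _ 0 0 H (continuity_2d_pt_Cmod 0 0 (mkposreal _ Hd))).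
        apply locally_2d_forall. intros v w H. apply Kd.
        change (0, 0) with (RtoC 0) in H. rewrite Cmod_0, Rminus_0_r in H. simpl in H.
        apply Rabs_def2 in H. lra. }
    apply (fun H => locally_2d_impl _ _ x y H L), locally_2d_forall.
    intros v w H. unfold u. destruct (Rle_dec _ _); assumption.
  - assert (Hw : 0 < Cmod (x, y) - r) by lra.
    apply (fun H => locally_2d_impl _ _ x y H (continuity_2d_pt_Cmod x y (mkposreal _ Hw))), locally_2d_forall.
    intros v w H. apply Rabs_def2 in H. simpl in H. unfold u.
    destruct (Rle_dec _ _); lra. }
assert (Hin : forall v w, Cmod (v, w) <= r -> weighted f (v, w) <= u x y).
{ intros v w Hvw. pose proof (Rmax_Cmod (v, w)) as H; simpl in H.
  pose proof (Rmax_l (Rabs v) (Rabs w)); pose proof (Rmax_r (Rabs v) (Rabs w)).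
  assert (Hv : -1 <= v <= 1) by (apply Rabs_le_between; lra).
  assert (Hw : -1 <= w <= 1) by (apply Rabs_le_between; lra).
  specialize (K v w Hv Hw). unfold u at 1 in K.
  destruct (Rle_dec _ _); [assumption|contradiction]. }
exists (x, y).
unfold u in Hin. destruct (Rle_dec (Cmod (x, y)) r) as [Hle|Hgt].
- split; [assumption|]. intros [v w]; apply Hin.
- exfalso. specialize (Hin 0 0).
  change (0, 0) with (RtoC 0) in Hin. rewrite Cmod_0 in Hin.
  specialize (Hin ltac:(lra)). pose proof (weighted_ge_0 f (RtoC 0)). lra.
Qed.

(** * The bound |f| <= 1/2 *)

Lemma weight_decreasing (s t : R) : s <= t -> weight t <= weight s.
Proof.
intros [H| ->]; [|lra]. unfold weight.
assert (exp (- (9 / 5) * t) < exp (- (9 / 5) * s)) by (apply exp_increasing; lra). lra.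
Qed.

Lemma Re_mul_conj_le (u v : C) : Re u * Re v + Im u * Im v <= Cmod u * Cmod v.
Proof.
rewrite <- (Cmod_conj v), <- Cmod_mult.
eapply Rle_trans; [apply Rle_abs|]. eapply Rle_trans; [|apply Rmax_Cmod].
eapply Rle_trans; [|apply Rmax_l]. right; f_equal. simpl. unfold Re, Im. ring.
Qed.

Lemma Cmod_le_half (a1 a2 : R) (f f1 f2 : C -> C) :
  0 < a1 -> 0 < a2 -> a1 - a2 >= exp 1 * (exp 1 - 1) ->
  (forall z, in_disk z -> is_derive_C f z (f1 z)) ->
  (forall z, in_disk z -> is_derive_C f1 z (f2 z)) ->
  f 0%C = 0%C ->
  (forall z, in_disk z -> Cmod (a1 * z * f1 z + a2 * (z * z) * f2 z) <= exp 1 - 1) ->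
  forall z, in_disk z -> Cmod (f z) <= 1 / 2.
Proof.
intros Ha1 Ha2 Ha Hf Hf1 H0 HG z Hz.
destruct (Cmod_ge_0 z) as [Hp|Hp].
2: { symmetry in Hp; apply Cmod_eq_0 in Hp; subst z; rewrite H0, Cmod_0; lra. }
unfold in_disk in Hz.
set (r := Cmod z) in *.
(* With r = |z|, the given point lies on the same circle as the maximiser, so the weights cancel in
   the comparison. *)
destruct (weighted_max f f1 r Hf H0) as [z0 [Hz0 Hmax]]; [lra|].
assert (Hi : in_disk z0) by (unfold in_disk; lra).
assert (Hmain : normsq (f z) <= 1 / 4).
2: { apply Cmod_le_of_sqr; [lra|]. unfold normsq in Hmain. lra. }
pose proof (Hmax z (Rle_refl _)) as Hzz.
pose proof (weight_pos (ln r)) as HW.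
destruct (Req_dec (normsq (f z0)) 0) as [Hn|Hn].
{ unfold weighted in Hzz. rewrite Hn in Hzz. fold r in Hzz.
  pose proof (normsq_ge_0 (f z)). nra. }
assert (Hz0p : 0 < Cmod z0).
{ apply Cmod_gt_0; intros ->. apply Hn. rewrite H0. unfold normsq; simpl; ring. }
destruct Hz0 as [Hlt|Heq].
{ exfalso. apply (no_interior_max f f1 f2 Hf Hf1 z0 Hi Hz0p (r - Cmod z0)); [lra|exact Hn|].
  intros z' Hz'. apply Hmax. lra. }
assert (Hle : normsq (f z) <= normsq (f z0)).
{ unfold weighted in Hzz. rewrite Heq in Hzz. fold r in Hzz. nra. }
apply Rle_trans with (1 := Hle).
destruct (tangential_conditions f f1 f2 Hf Hf1 z0 Hi) as [_ T].
{ intros z' E; apply Hmax; lra. }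
pose proof (radial_condition f f1 Hf z0 Hi Hz0p) as R.
specialize (R ltac:(intros z' Hz'; apply Hmax; lra)).
specialize (HG z0 Hi).
pose proof (Re_mul_conj_le (a1 * z0 * f1 z0 + a2 * (z0 * z0) * f2 z0) (f z0)) as E.
pose proof (Cmod_sqr (f z0)) as S. pose proof (Cmod_ge_0 (f z0)) as Sp.
fold (normsq (f z0)) in S. pose proof (normsq_ge_0 (f z0)).
assert (W9 : 10 <= weight (ln (Cmod z0))).
{ replace 10 with (weight 0) by (unfold weight; rewrite Rmult_0_r, exp_0; ring).
  apply weight_decreasing. rewrite <- ln_1. apply ln_le; lra. }
set (V := weight (ln (Cmod z0))) in *.
set (N := normsq (f z0)) in *.
set (m := Re (z0 * f1 z0) * Re (f z0) + Im (z0 * f1 z0) * Im (f z0)) in *.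
(* The radial condition reads 2 m V >= 9/5 (V - 1) N, and V >= 10 makes the right side at least 8/5
   V N. *)
assert (Hm : 4 / 5 * N <= m).
{ apply (Rmult_le_reg_r (2 * V)); [lra|].
  assert (N * (V - 10) >= 0) by (apply Rle_ge, Rmult_le_pos; lra). lra. }
set (k := Re (f z0) * Re (z0 * (f1 z0 + z0 * f2 z0)) + Im (f z0) * Im (z0 * (f1 z0 + z0 * f2 z0))) in *.
assert (Hk : 0 <= k) by nra.
(* z q' = z f' + z^2 f'', so a1 z f' + a2 z^2 f'' = (a1 - a2) q + a2 z q'. *)
assert (E' : (a1 - a2) * m + a2 * k <= (exp 1 - 1) * Cmod (f z0)).
{ apply Rle_trans with (Cmod (a1 * z0 * f1 z0 + a2 * (z0 * z0) * f2 z0) * Cmod (f z0)).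
  - eapply Rle_trans; [right|exact E]. unfold m, k.
    destruct z0, (f1 _), (f2 _), (f _); unfold RtoC, Re, Im; simpl; ring.
  - apply Rmult_le_compat_r; assumption. }
pose proof exp_1_ge.
assert (F : exp 1 * (exp 1 - 1) * (4 / 5 * N) <= (exp 1 - 1) * Cmod (f z0)).
{ apply Rle_trans with ((a1 - a2) * m).
  - apply Rmult_le_compat; nra.
  - assert (0 <= a2 * k) by (apply Rmult_le_pos; lra). lra. }
assert (F' : exp 1 * (4 / 5 * N) <= Cmod (f z0)).
{ apply (Rmult_le_reg_l (exp 1 - 1)); lra. }
(* e >= 5/2 gives 4/5 e >= 2; with N = |f(z0)|^2 this yields |f(z0)| <= 1/2. *)
assert (2 * N <= Cmod (f z0)) by nra.
nra.
Qed.

(** * From the bound on p - 1 to the subordination *)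

Theorem theorem4p10 (a1 a2 : R) :
  0 < a1 -> 0 < a2 -> a1 - a2 >= exp 1 * (exp 1 - 1) ->
  forall p p1 p2 : C -> C,
    (forall z, in_disk z -> is_derive (K := C_AbsRing) (V := C_NormedModule) p z (p1 z)) ->
    (forall z, in_disk z -> is_derive (K := C_AbsRing) (V := C_NormedModule) p1 z (p2 z)) ->
    p 0%C = 1%C ->
    subordinate (fun z => (1 + RtoC a1 * z * p1 z + RtoC a2 * (z * z) * p2 z)%C) cexp ->
    subordinate p cexp.
Proof.
intros Ha1 Ha2 Ha p p1 p2 Hp Hp1 H0 [w [_ [Hw [_ Hsub]]]].
assert (Hhalf : forall z, in_disk z -> Cmod (p z - 1) <= 1 / 2).
{ apply (Cmod_le_half a1 a2 (fun z => p z - 1)%C p1 p2); try assumption.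
  - intros z Hz. evar_last.
    + apply (is_derive_minus (K := C_AbsRing) (V := C_NormedModule)); [exact (Hp z Hz)|].
      apply (is_derive_const (K := C_AbsRing) (V := C_NormedModule)).
    + unfold minus, plus, opp, zero; simpl. ring.
  - rewrite H0; ring.
  - intros z Hz. specialize (Hsub z Hz); simpl in Hsub.
    replace (a1 * z * p1 z + a2 * (z * z) * p2 z)%C with (cexp (w z) - 1)%C
      by (rewrite <- Hsub; ring).
    apply Cmod_cexp_sub_1. apply Rlt_le, Hw, Hz. }
(* The values of p have positive real part, so the logarithm is analytic along p and [cexp] inverts
   it. *)
exists (fun z => clog (p z)). repeat split.
- intros z Hz. eexists.
  apply (is_derive_comp (K := C_AbsRing) (V := C_NormedModule) clog p);
  [|apply is_derive_C_AbsRing; exact (Hp z Hz)].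
  apply is_derive_clog, Re_pos_of_near_1, Hhalf, Hz.
- intros z Hz. apply Cmod_clog_lt_1, Hhalf, Hz.
- rewrite H0. unfold clog; simpl. unfold RtoC; f_equal.
  + replace (1 * 1 + 0 * 0) with 1 by ring. rewrite ln_1; field.
  + replace (0 / 1) with 0 by field. apply atan_0.
- intros z Hz. symmetry. apply cexp_clog, Re_pos_of_near_1, Hhalf, Hz.
Qed.
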